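(* Let $G$ be a finitely generated solvable group and let $S$ be a nice generating set for $G$. Suppose $G$ acts topologically transitively (by homeomorphisms) on a compact metric space $X$. For $s\in S$ write $\langle s\rangle$ for the subgroup of $G$ generated by $s$. If for each $s\in S$ the system $(X,\langle s\rangle)$ has a dense set of minimal points, then either $(X,G)$ is minimal and equicontinuous, or $(X,G)$ has sensitive dependence on initial conditions.
   Context: Put $G^{(0)}=G$ and $G^{(n+1)}=[G^{(n)},G^{(n)}]$. A finite set $S$ generating a solvable group $G$ is called nice if, for every $n\ge 0$, $G^{(n)}$ is generated by $S\cap G^{(n)}$. Let a group $H$ act by homeomorphisms on a compact metric space $(X,d)$. The system $(X,H)$ is topologically transitive if for all nonempty open $U,V\subseteq X$ there is $h\in H$ with $U\cap h.V\neq\emptyset$. It is minimal if every point has dense $H$-orbit. A point $x\in X$ is a minimal point of $(X,H)$ if the orbit closure $\overline{H.x}$ is a minimal system under $H$. The system is equicontinuous if the family $\{x\mapsto h.x: h\in H\}$ is (uniformly) equicontinuous. It has sensitive dependence on initial conditions if there is $\varepsilon>0$ such that for every $x\in X$ and every open neighborhood $U$ of $x$ there exist $y\in U$ and $h\in H$ with $d(h.x,h.y)>\varepsilon$. *)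

(* Defs.v *)
From mathcomp Require Export all_boot all_order all_algebra.
From mathcomp Require Export all_classical all_reals topology.

Set Implicit Arguments.
Unset Strict Implicit.
Unset Printing Implicit Defensive.

Import Order.TTheory GRing.Theory Num.Theory.

Local Open Scope classical_set_scope.
Local Open Scope ring_scope.

Section Groups.
Context {G : groupType}.
Implicit Types (A B S : set G).

Definition subgroup_gen A : set G :=
  smallest (fun H : set G => group_closed [in H]) A.

Definition commutator_subgroup A B : set G :=
  subgroup_gen [set [~ a, b]%g | a in A & b in B].

Fixpoint derived_series (n : nat) : set G :=
  if n is m.+1 then commutator_subgroup (derived_series m) (derived_series m)
  else [set: G].

Definition nice_generating_set S : Prop :=
  [/\ finite_set S,
      subgroup_gen S = [set: G]
    & forall n, subgroup_gen (S `&` derived_series n) = derived_series n].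

End Groups.

Definition finitely_generated (G : groupType) : Prop :=
  exists2 S : set G, finite_set S & subgroup_gen S = [set: G].

Definition solvable_group (G : groupType) : Prop :=
  exists n, @derived_series G n = [set 1%g].

Definition homeomorphism {X Y : topologicalType} (f : X -> Y) : Prop :=
  continuous f /\
  exists g : Y -> X, [/\ continuous g, cancel f g & cancel g f].

Definition action_by_homeomorphisms {G : groupType} {X : topologicalType}
    (act : G -> X -> X) : Prop :=
  [/\ forall x, act 1%g x = x,
      forall g h x, act (g * h)%g x = act g (act h x)
    & forall g, homeomorphism (act g)].

(* In what follows the set [H] is meant to be a subgroup of [G]; the system
   (X, H) is the restriction of the action [act] of [G] to [H]. *)

Section Systems.
Context {G : groupType} {X : topologicalType}.
Variables (act : G -> X -> X) (H : set G).

Definition orbit_of (x : X) : set X := [set act h x | h in H].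

Definition topologically_transitive : Prop :=
  forall U V : set X, open U -> U !=set0 -> open V -> V !=set0 ->
    exists2 h, H h & U `&` (act h @` V) !=set0.

(* Minimality of the subsystem carried by an [H]-invariant set [Y]: the orbit
   of every point of [Y] is dense in [Y]. *)
Definition minimal_on (Y : set X) : Prop :=
  forall y, Y y -> Y `<=` closure (orbit_of y).

Definition minimal_system : Prop := minimal_on [set: X].

Definition minimal_point (x : X) : Prop := minimal_on (closure (orbit_of x)).

End Systems.

Section MetricSystems.
Context {R : realType} {G : groupType} {X : metricType R}.
Variables (act : G -> X -> X) (H : set G).

(* Uniform equicontinuity; [function_spaces.equicontinuous] is the pointwise
   notion. *)
Definition equicontinuous_system : Prop :=
  forall e : R, 0 < e -> exists2 d : R, 0 < d &
    forall x y : X, mdist x y < d ->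
      forall h, H h -> mdist (act h x) (act h y) < e.

Definition sensitive_system : Prop :=
  exists2 e : R, 0 < e &
    forall (x : X) (U : set X), open U -> U x ->
      exists y h, [/\ U y, H h & e < mdist (act h x) (act h y)].

End MetricSystems.

(* Main.v *)
(** Write [E e] for the open invariant set of points having a neighbourhood all
    of whose translates have diameter at most [e], and let [E] be the
    intersection of these sets.  If the system is not sensitive, every [E e] is
    nonempty, hence dense by transitivity, so [E] is nonempty by Baire.
    Call [A] in [G] tame if the closure of [A x] lies in [E] for all [x] in [E].
    If the minimal points of a subgroup [H] are dense, then [H] is tame: for [x]
    in [E], a minimal point [y] close to [x] shadows [x] along [H], so every
    point of the closure of [H x] returns close to [x].  A product of two tame
    sets is tame by compactness.  A nice generating set writes [G] as a product
    of finitely many cyclic groups [<s>], so [G] itself is tame; since every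
    point of [E] has a dense orbit, [E] is the whole space. *)
Require Import Defs.
From mathcomp Require Import lra.

Set Implicit Arguments.
Unset Strict Implicit.
Unset Printing Implicit Defensive.

Import Order.TTheory GRing.Theory Num.Theory.

Local Open Scope classical_set_scope.

(** * Generated subgroups and products of cyclic groups *)

Section Subgroups.
Local Open Scope group_scope.
Context {G : groupType}.
Implicit Types (A B D H M N S : set G) (P : set G -> Prop).

Lemma group_closed_setP H : group_closed [in H] <->
  [/\ H 1, forall x y, H x -> H y -> H (x * y) & forall x, H x -> H x^-1].
Proof.
split=> [grH|[H1 HM HV]].
  have [H1 _] := grH; split; first by rewrite inE in H1.
  - by move=> x y Hx Hy; have := group_closedM grH (mem_set Hx) (mem_set Hy);
      rewrite inE.
  - by move=> x Hx; have := group_closedV grH (mem_set Hx); rewrite inE.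
split; first exact: mem_set.
by move=> x y /set_mem Hx /set_mem Hy; apply/mem_set/HM => //; apply: HV.
Qed.

Lemma subgroup_gen_closed A : group_closed [in subgroup_gen A].
Proof.
apply/group_closed_setP; split=> [H [/group_closed_setP[]//]|x y Ax Ay H HA|].
  have [/group_closed_setP[_ HM _] _] := HA.
  by apply: HM; [apply: Ax|apply: Ay].
move=> x Ax H HA; have [/group_closed_setP[_ _ HV] _] := HA.
by apply: HV; apply: Ax.
Qed.

Lemma derived_series_closed n : group_closed [in @derived_series G n].
Proof.
by case: n => [|n]; [apply/group_closed_setP|exact: subgroup_gen_closed].
Qed.

Lemma derived_seriesS_sub n :
  @derived_series G n.+1 `<=` @derived_series G n.
Proof.
apply: smallest_sub; first exact: derived_series_closed.
have /group_closed_setP[_ DM DV] := derived_series_closed n.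
move=> _ [a Da [b Db <-]].
exact: (DM) (DV _ Da) (DM _ _ (DV _ Db) (DM _ _ Da Db)).
Qed.

Definition set_mul A B : set G := [set a * b | a in A & b in B].

Lemma set_mul_closed A M : group_closed [in A] -> group_closed [in M] ->
  (forall a m, A a -> M m -> M (m ^ a)) -> group_closed [in set_mul A M].
Proof.
move=> /group_closed_setP[A1 AM AV] /group_closed_setP[M1 MM MV] AJ.
apply/group_closed_setP; split.
- by exists 1 => //; exists 1 => //; rewrite mulg1.
- move=> _ _ [a Aa [m Mm <-]] [b Ab [n Mn <-]].
  exists (a * b); first exact: AM.
  (* Moving [b] to the left past [m] replaces [m] by [m ^ b]. *)
  exists (m ^ b * n); first by apply: MM => //; exact: AJ.
  by rewrite /conjg !mulgA mulgK.
- move=> _ [a Aa [m Mm <-]]; exists a^-1; first exact: AV.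
  exists (m^-1 ^ a^-1); first by apply: AJ; [exact: AV|exact: MV].
  by rewrite /conjg invgK !mulgA mulVg mul1g invgM.
Qed.

(** Multiplying on the left by the cyclic groups of the elements of [s], one at a time, keeps a
    subgroup between [N] and [D]. So [P], which need only pass to products, climbs from [N] to a
    subgroup that also contains [s]. *)
Lemma cyclic_product_extension P D N (s : seq G) :
  group_closed [in D] -> group_closed [in N] -> N `<=` D ->
  (forall x y, D x -> D y -> N [~ x, y]) ->
  (forall A B, P A -> P B -> P (set_mul A B)) -> P N ->
  (forall t, t \in s -> D t /\ P (subgroup_gen [set t])) ->
  exists M, [/\ P M, group_closed [in M], N `<=` M, M `<=` D
              & [set` s] `<=` M].
Proof.
move=> grD grN ND NR PM PN; elim: s => [_|t s IHs sP].
  by exists N; split=> // x; rewrite /= in_nil.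
have {IHs}[|M [PM' grM NM MD sM]] := IHs.
  by move=> u us; apply: sP; rewrite inE us orbT.
have [Dt Pt] := sP _ (mem_head _ _).
have /group_closed_setP[D1 DM DV] := grD.
have /group_closed_setP[M1 MM MV] := grM.
have tD : subgroup_gen [set t] `<=` D by apply: smallest_sub => // _ ->.
have grt := subgroup_gen_closed [set t].
have /group_closed_setP[t1 _ _] := grt.
exists (set_mul (subgroup_gen [set t]) M); split.
- exact: PM.
- (* [D] normalizes [M] because [M] contains the commutators of [D]. *)
  apply: set_mul_closed => // a m /tD Da Mm.
  have -> : m ^ a = m * [~ m, a] by rewrite /commg mulVKg.
  by apply: MM => //; apply/NM/NR => //; exact: MD.
- by move=> x /NM Mx; exists 1 => //; exists x => //; rewrite mul1g.
- by move=> _ [a /tD Da [m /MD Dm <-]]; exact: DM.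
- move=> x /=; rewrite inE => /orP[/eqP ->|xs].
    exists t; first exact: sub_gen_smallest.
    by exists 1 => //; rewrite mulg1.
  by exists 1 => //; exists x; [exact: sM|rewrite mul1g].
Qed.

(** The induction climbs the derived series from its trivial term. Niceness makes each term
    generated by elements of [S], and the next term contains its commutators, so one cyclic
    extension reaches it. *)
Lemma solvable_nice_ind P S : solvable_group G -> nice_generating_set S ->
  P [set 1] -> (forall A B, P A -> P B -> P (set_mul A B)) ->
  (forall t, S t -> P (subgroup_gen [set t])) -> P [set: G].
Proof.
move=> [n Dn1] [finS _ Sn] P1 PM PS.
suff PD k : (k <= n)%N -> P (derived_series (n - k)).
  by have := PD n (leqnn n); rewrite subnn.
elim: k => [_|k IHk kn]; first by rewrite subn0 Dn1.
have {IHk} := IHk (ltnW kn).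
rewrite -(subnSK kn); set m := (n - k.+1)%N => PDm.
have [s Ds] : exists s : seq G, S `&` derived_series m = [set` s].
  by apply/finite_seqP/(sub_finite_set _ finS); exact: subIsetl.
have [||M [PM' grM _ MD sM]] := cyclic_product_extension
    (derived_series_closed m) (derived_series_closed m.+1)
    (@derived_seriesS_sub m) _ PM PDm (s := s).
- by move=> x y Dx Dy; apply: sub_gen_smallest; exists x => //; exists y.
- move=> t ts; have [St Dt] : (S `&` derived_series m) t by rewrite Ds.
  by split => //; exact: PS.
suff -> : derived_series m = M by [].
apply/seteqP; split => //; rewrite -Sn.
by apply: smallest_sub => //; rewrite Ds.
Qed.

End Subgroups.

(** * Compactness and Baire category *)

(** This replaces passing to a subnet: along indices with [f i] tending to [z], the values [g i]
    accumulate at some [w]. *)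
Lemma closure_image_compact (I : Type) (T U : topologicalType) (D : set I)
    (f : I -> T) (g : I -> U) (z : T) :
  compact [set: U] -> closure (f @` D) z ->
  exists w : U, forall V W, nbhs z V -> nbhs w W ->
    exists2 i, D i & V (f i) /\ W (g i).
Proof.
move=> /compact_near_coveringP cU zD; apply: contrapT => nw.
(* Without such a [w], each point has a neighbourhood that fails with some neighbourhood of [z];
   compactness makes the latter uniform. *)
pose P z' w' := forall i, D i -> f i = z' -> g i <> w'.
have /zD[_ [[i Di <-] PU]] : \forall z' \near z, [set: U] `<=` P z'.
  apply: cU => w _; apply: contrapT => nP; apply: nw; exists w => V W zV wW.
  apply: contrapT => nD; apply: nP; exists (W, V) => //= -[w' z'] [/= Ww Vz].
  by move=> i Di fi gi; apply: nD; exists i => //; rewrite fi gi.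
exact: PU Di erefl erefl.
Qed.

Lemma compact_hausdorff_Baire (T : topologicalType) (F : nat -> set T) :
  hausdorff_space T -> compact [set: T] ->
  (forall n, open (F n) /\ dense (F n)) -> dense (\bigcap_n F n).
Proof.
move=> hT cT oF W [x0 Wx0] oW.
have refine n (V : set T) : open V -> V !=set0 ->
    exists U, [/\ open U, U !=set0 & closure U `<=` V `&` F n].
  move=> oV V0; have [oFn dFn] := oF n; have [x VFx] := dFn _ V0 oV.
  have rx := compact_regular hT cT (filterT : nbhs x [set: T]).
  have /rx[U xU UVF] := open_nbhs_nbhs (conj (openI oV oFn) VFx).
  exists U°; split; [exact: open_interior|by exists x|].
  by apply: subset_trans UVF; apply: closureS; exact: interior_subset.
(* The state carries the stage number because the relation itself cannot depend on the step. *)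
pose R (p q : nat * set T) := q.1 = p.1.+1 /\
  (open p.2 -> p.2 !=set0 ->
   [/\ open q.2, q.2 !=set0 & closure q.2 `<=` p.2 `&` F p.1]).
(* Dependent choice needs [R] total, hence the preconditions on [p.2] inside it. *)
have [p|u [u0 uR]] := @dependent_choice _ R _ (0%N, W).
  apply: cid; have [oV|] := pselect (open p.2); last by exists (p.1.+1, setT).
  have [V0|] := pselect (p.2 !=set0); last by exists (p.1.+1, setT).
  by have [U UP] := refine p.1 _ oV V0; exists (p.1.+1, U).
have un n : (u n).1 = n by elim: n => [|n IHn]; rewrite ?u0// (uR n).1 IHn.
have uO n : open (u n).2 /\ (u n).2 !=set0.
  elim: n => [|n [oV V0]]; first by rewrite u0; split => //; exists x0.
  by have [] := (uR n).2 oV V0.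
have uS n : closure (u n.+1).2 `<=` (u n).2 `&` F n.
  by have [oV V0] := uO n; have [_ _] := (uR n).2 oV V0; rewrite un.
have uD n m : (n <= m)%N -> (u m).2 `<=` (u n).2.
  move=> /subnK <-; elim: (m - n)%N => [//|k IHk] x ux; apply: IHk.
  by have [] := uS _ _ (subset_closure ux).
have [y yu] := choice (fun n => (uO n).2).
have [p [_ pF]] := cT (y @ \oo) _ filterT.
(* All but finitely many terms of [y] lie in the [n]-th set, so a cluster point lies in its
   closure. *)
have pu n : closure (u n).2 p.
  move=> V pV; apply: pF => //; exists n => // m /= nm.
  exact: uD nm _ (yu m).
exists p; split; first by have [] := uS 0 _ (pu 1%N); rewrite u0.
by move=> n _; have [] := uS n _ (pu n.+1).
Qed.

(** * Stable points, tame sets and equicontinuity *)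

Section StablePoints.
Local Open Scope ring_scope.
Context {R : realType} {G : groupType} {X : metricType R}.
Variable act : G -> X -> X.
Hypothesis actX : action_by_homeomorphisms act.
Implicit Types (A B H : set G) (x y z : X) (e : R).

(** This is the set [E e] of the overview, and [equicontinuity_points] is [E]. *)
Definition stable e : set X := [set x | exists2 U, nbhs x U &
  forall y z, U y -> U z -> forall g, mdist (act g y) (act g z) <= e].

Definition equicontinuity_points : set X :=
  [set x | forall e, 0 < e -> stable e x].

Definition tame A : Prop := forall x, equicontinuity_points x ->
  closure (orbit_of act A x) `<=` equicontinuity_points.

Lemma act_continuous g : continuous (act g).
Proof. by have [_ _ /(_ g)[]] := actX. Qed.

Lemma nbhs_mball x e : 0 < e -> nbhs x [set y | mdist x y < e].
Proof. by move=> e0; rewrite -ballEmdist; exact: nbhsx_ballx. Qed.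

Lemma nbhs_mballP x (U : set X) :
  nbhs x U -> exists2 e, 0 < e & forall y, mdist x y < e -> U y.
Proof.
rewrite -nbhs_ballE => -[e e0 xU]; exists e => // y xy.
by apply: xU; rewrite ballEmdist.
Qed.

Lemma stable_open e : open (stable e).
Proof.
rewrite openE => x [U xU US]; apply: filterS (nbhs_interior xU) => y yU.
by exists U.
Qed.

Lemma stable_act e g x : stable e (act g x) -> stable e x.
Proof.
have [_ actM _] := actX.
move=> [U gU US]; exists (act g @^-1` U); first exact: act_continuous.
move=> y z Uy Uz h.
by have := US _ _ Uy Uz (h * g^-1)%g; rewrite -!actM mulgVK.
Qed.

Lemma stable_near_dist e x : 0 < e -> equicontinuity_points x ->
  \forall y \near x, forall g, mdist (act g y) (act g x) <= e.
Proof.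
move=> e0 /(_ e e0)[U xU US]; apply: filterS (xU) => y Uy g.
by apply: US => //; exact: nbhs_singleton.
Qed.

Lemma tame1 : tame [set 1%g].
Proof.
have [act1 _ _] := actX.
move=> x Ex z zx.
suff -> : z = x by [].
apply: (@metric_hausdorff R X) => V W zV xW.
have [_ [[_ -> <-] Vx]] := zx _ zV.
by exists x; rewrite act1 in Vx; split => //; exact: nbhs_singleton.
Qed.

(** If [a b x] tends to [z], let [k] be a limit of [b x]. Tameness of [B] puts [k] in [E], so [a k]
    stays close to [a b x], and [z] is in the closure of [A k]. *)
Lemma tame_mul A B : compact [set: X] -> tame A -> tame B -> tame (set_mul A B).
Proof.
have [_ actM _] := actX.
move=> cX tA tB x Ex z zAB.
have [|k zk] := @closure_image_compact _ _ _ (A `*` B)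
  (fun p => act (p.1 * p.2)%g x) (fun p => act p.2 x) z cX.
  apply: closureS zAB => _ [_ [a Aa [b Bb <-]] <-].
  by exists (a, b).
have Ek : equicontinuity_points k.
  apply: tB Ex _ _ => V kV.
  have [[a b] [/= Aa Bb] [_ Vb]] := zk _ _ filterT kV.
  by exists (act b x); split => //; exists b.
apply: (tA _ Ek) => V /nbhs_mballP[e e0 zV].
have e2 : 0 < e / 2 by rewrite divr_gt0.
have [[a b] [/= Aa Bb] [zab kb]] :=
  zk _ _ (nbhs_mball z e2) (stable_near_dist e2 Ek).
exists (act a k); split; first by exists a.
apply: zV; apply: le_lt_trans (metric_triangle _ (act (a * b)%g x) _) _.
by have := kb a; rewrite -actM /=; move: zab => /=; lra.
Qed.

(** Take [i] in [H] with [i x] near [z] and [i y] near [w], and [h] in [H] with [h w] near [y], by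
    minimality. Then [h z] is near [h i x], [h i y], [h w], [y] and finally [x], so [h z] is stable,
    and so is [z]. *)
Lemma tame_minimal_dense H : compact [set: X] -> H 1%g ->
  dense (minimal_point act H) -> tame H.
Proof.
have [act1 actM _] := actX.
move=> cX H1 dH x Ex z zH e e0.
have [r r0 xr] :=
  nbhs_mballP (open_nbhs_nbhs (conj (@stable_open e) (Ex e e0))).
(* The chain from [x] to [h z] has five links of length at most [d]. *)
pose d := r / 8.
have d0 : 0 < d by rewrite divr_gt0.
have xU : nbhs x [set y | mdist x y < d /\
    forall g, mdist (act g y) (act g x) <= d]°.
  apply/nbhs_interior/filterI; first exact: nbhs_mball.
  exact: stable_near_dist.
have [y [/interior_subset[/= xy yx] ymin]] :=
  dH _ (ex_intro _ _ (nbhs_singleton xU)) (@open_interior _ _).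
have [w zw] := @closure_image_compact _ _ _ H
  (act^~ x) (act^~ y) z cX zH.
have yw : closure (orbit_of act H y) w.
  move=> V wV; have [h Hh [_ Vh]] := zw _ _ filterT wV.
  by exists (act h y); split => //; exists h.
have yy : closure (orbit_of act H y) y.
  by apply: subset_closure; exists 1%g.
have [_ [[h Hh <-] yhw]] := ymin _ yw _ yy _ (nbhs_mball y d0).
have [i Hi [hi1 hi2]] := zw _ _ (act_continuous (nbhs_mball (act h z) d0))
  (act_continuous (nbhs_mball (act h w) d0)).
apply: (@stable_act _ h); apply: xr; move: hi1 hi2 xy yhw => /=.
rewrite -!actM => hi1 hi2 xy yhw; have hi := yx (h * i)%g.
have t1 := metric_triangle x y (act h z).
have t2 := metric_triangle y (act h w) (act h z).
have t3 := metric_triangle (act h w) (act (h * i)%g y) (act h z).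
have t4 := metric_triangle (act (h * i)%g y) (act (h * i)%g x) (act h z).
have := metric_sym (act h z) (act (h * i)%g x).
by move: hi1 hi2 xy yhw hi t1 t2 t3 t4; rewrite /d; lra.
Qed.

(** Transitivity moves some [u] near [x] close to [v], and [g x] stays close to [g u]. *)
Lemma equicontinuity_point_dense_orbit x :
  topologically_transitive act [set: G] -> equicontinuity_points x ->
  closure (orbit_of act [set: G] x) = [set: X].
Proof.
move=> tX Ex; apply/seteqP; split => // v _ V /nbhs_mballP[e e0 vV].
have e2 : 0 < e / 2 by rewrite divr_gt0.
have xU := nbhs_interior (stable_near_dist e2 Ex).
have vU := nbhs_interior (nbhs_mball v e2).
have [g _ [w [/interior_subset/= vw [u /interior_subset/= xu guw]]]] :=
  tX _ _ (@open_interior _ _) (ex_intro _ _ (nbhs_singleton vU))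
    (@open_interior _ _) (ex_intro _ _ (nbhs_singleton xU)).
exists (act g x); split; first by exists g.
apply: vV; apply: le_lt_trans (metric_triangle _ (act g u) _) _.
by have := xu g; rewrite guw; lra.
Qed.

Lemma stable_dense e : topologically_transitive act [set: G] ->
  stable e !=set0 -> dense (stable e).
Proof.
move=> tX S0 V V0 oV.
have [g _ [u [Su [v Vv gv]]]] := tX _ _ (@stable_open e) S0 oV V0.
by exists v; split => //; apply: (@stable_act _ g); rewrite gv.
Qed.

Lemma not_sensitive_stable e : 0 < e -> ~ sensitive_system act [set: G] ->
  stable e !=set0.
Proof.
(* Two points of a neighbourhood are compared through its centre [x], which doubles the constant. *)
move=> e0; apply: contra_notP => S0; exists (e / 2); first by rewrite divr_gt0.
move=> x U oU Ux; apply: contrapT => nU; apply: S0; exists x, U.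
  exact: open_nbhs_nbhs.
have xU y g : U y -> mdist (act g x) (act g y) <= e / 2.
  by move=> Uy; rewrite leNgt; apply/negP => xy; apply: nU; exists y, g.
move=> y z Uy Uz g.
apply: le_trans (metric_triangle _ (act g x) _) _.
by have := xU y g Uy; have := xU z g Uz; rewrite [X in X + _]metric_sym; lra.
Qed.

Lemma equicontinuity_points_nonempty :
  compact [set: X] -> [set: X] !=set0 ->
  topologically_transitive act [set: G] -> ~ sensitive_system act [set: G] ->
  equicontinuity_points !=set0.
Proof.
move=> cX X0 tX nS.
have en n : 0 < n.+1%:R^-1 :> R by rewrite invr_gt0.
have [|x [_ xS]] := @compact_hausdorff_Baire _ (fun n => stable n.+1%:R^-1)
    (@metric_hausdorff R X) cX _ _ X0 openT.
  move=> n; split; first exact: stable_open.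
  by apply: stable_dense => //; exact: not_sensitive_stable.
(* This index [n] makes the inverse of [n + 1] smaller than [e]. *)
exists x => e e0; have [U xU US] := xS (Num.truncn e^-1) I.
exists U => // y z Uy Uz g; apply: le_trans (US _ _ Uy Uz g) _.
rewrite -[leRHS]invrK lef_pV2 ?posrE ?invr_gt0//.
by apply/ltW; exact: truncnS_gt.
Qed.

Lemma equicontinuous_system_of_points : compact [set: X] ->
  equicontinuity_points = [set: X] -> equicontinuous_system act [set: G].
Proof.
move=> /compact_near_coveringP cX ET e e0.
have e2 : 0 < e / 2 by rewrite divr_gt0.
have eX : \forall d \near 0^'+, [set: X] `<=` fun x =>
    forall y, mdist x y < d -> forall g, mdist (act g x) (act g y) < e.
  apply: cX => x _; have Ex : equicontinuity_points x by rewrite ET.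
  have [U xU US] := Ex _ e2; have [r r0 xr] := nbhs_mballP xU.
  have r2 : 0 < r / 2 by rewrite divr_gt0.
  (* A point within [d] of [x'] is then within [r] of [x], like [x'] itself. *)
  exists ([set x' | mdist x x' < r / 2], [set d | d < r / 2]).
    by split; [exact: nbhs_mball|exact: nbhs_right_lt].
  move=> [x' d] [/= xx' dr] y x'y g.
  suff : mdist (act g x') (act g y) <= e / 2 by lra.
  by apply: US; apply: xr; [|have := metric_triangle x x' y]; lra.
have [d [d0 dX]] := filter_ex (filterI (nbhs_right_gt 0) eX).
by exists d => // x y xy g _; exact: (dX x).
Qed.
End StablePoints.

Theorem theorem1p11 (R : realType) (G : groupType) (X : metricType R)
    (S : set G) (act : G -> X -> X)
    (fgG : finitely_generated G) (solG : solvable_group G)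
    (niceS : nice_generating_set S)
    (cptX : compact [set: X])
    (actX : action_by_homeomorphisms act)
    (transX : topologically_transitive act [set: G])
    (minX : forall s, S s -> dense (minimal_point act (subgroup_gen [set s]))) :
  (minimal_system act [set: G] /\ equicontinuous_system act [set: G]) \/
  sensitive_system act [set: G].
Proof.
have [|nS] := pselect (sensitive_system act [set: G]); [by right|left].
have tG : tame act [set: G].
  apply: (solvable_nice_ind solG niceS); first exact: tame1.
  - by move=> A B; exact: tame_mul.
  - move=> s Ss; apply: tame_minimal_dense => //; last exact: minX.
    by have /group_closed_setP[] := subgroup_gen_closed [set s].
have dE x := @equicontinuity_point_dense_orbit _ _ _ _ x transX.
have ET : equicontinuity_points act = [set: X].
  apply/seteqP; split => // y _.
  (* The point [y] also witnesses that the space is nonempty. *)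
  have [x Ex] :=
    equicontinuity_points_nonempty actX cptX (ex_intro _ y I) transX nS.
  by apply: (tG _ Ex); rewrite dE.
split; last exact: equicontinuous_system_of_points.
by move=> x _; rewrite dE // ET.
Qed.
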